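(* Let $m$ be a positive integer, let $i_1,\dots,i_N$ be pairwise distinct integers, let $\mathcal U=\{m i_1,m i_2,\dots,m i_N\}$ (i.e. $l_k=m i_k$ for $k=1,\dots,N$), and let $r$ be a real number in $(0,1)$. If $mr$ is an integer, then the $N\times N$ matrices $S_{11},S_{12},S_{21},S_{22}$ associated with $\mathcal U$, $\omega$ and $r$ satisfy $$S_{11}=(2r-r^2)\,I,\qquad S_{22}=r^2\, I,\qquad S_{12}=0,$$ where $I$ is the $N\times N$ identity matrix. Moreover the entries of $S_{21}$ are $$S_{21}(k,j)=\begin{cases}(1-r)\,\dfrac{\omega}{m\pi\,(i_k-i_j)} & \text{if } k\neq j,\\[2mm] 0 & \text{if } k=j.\end{cases}$$
   Context: Let $\omega>0$ be a real number, $r\in(0,1)$ the oversampling parameter, and $t_o=2\pi r/\omega$ (so $r=\omega t_o/(2\pi)$). Write $\mathrm{sinc}(x)=\sin(x)/x$ for $x\ne0$ and $\mathrm{sinc}(0)=1$. Define the functions $\widetilde\varphi_1,\widetilde\varphi_2:\mathbb R\to\mathbb R$ by $$\widetilde\varphi_1(x)=\frac1{\sqrt{2\pi}}\Big[2r(1-r)\,\mathrm{sinc}(\omega x)+r^2\,\mathrm{sinc}^2\big(\tfrac{\omega x}{2}\big)\Big],\qquad \widetilde\varphi_2(x)=-\frac1{\sqrt{2\pi}}\,r^2\,x\,\mathrm{sinc}^2\big(\tfrac{\omega x}{2}\big),$$ and let $\widetilde\varphi_1',\widetilde\varphi_2'$ be their derivatives. For a set $\mathcal U=\{l_1,\dots,l_N\}$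 of $N\ge1$ distinct integers, the real $N\times N$ matrices $S_{11},S_{12},S_{21},S_{22}$ are defined, for $k,j=1,\dots,N$, by $$S_{11}(k,j)=\sqrt{2\pi}\,\widetilde\varphi_1((l_k-l_j)t_o),\qquad S_{12}(k,j)=-\sqrt{2\pi}\,\widetilde\varphi_2((l_k-l_j)t_o),$$ $$S_{21}(k,j)=\sqrt{2\pi}\,\widetilde\varphi_1'((l_k-l_j)t_o),\qquad S_{22}(k,j)=-\sqrt{2\pi}\,\widetilde\varphi_2'((l_k-l_j)t_o).$$ *)

(* Defs.v *)
From HB Require Import structures.
From mathcomp Require Import all_boot all_order all_algebra.
From mathcomp Require Import all_classical all_reals all_analysis.
Set Implicit Arguments.
Unset Strict Implicit.
Unset Printing Implicit Defensive.
Import Order.TTheory GRing.Theory Num.Theory.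
Import numFieldNormedType.Exports.
Local Open Scope ring_scope.

Section Oversampling.
Variable R : realType.

Definition sinc (x : R) : R := if x == 0 then 1 else sin x / x.

Variables omega r : R.

Definition sampling_step : R := 2 * pi * r / omega.

Definition phit1 (x : R) : R :=
  (Num.sqrt (2 * pi))^-1 *
  (2 * r * (1 - r) * sinc (omega * x) + r ^+ 2 * sinc (omega * x / 2) ^+ 2).

Definition phit2 (x : R) : R :=
  - ((Num.sqrt (2 * pi))^-1 * (r ^+ 2 * x * sinc (omega * x / 2) ^+ 2)).

(* The index set U = {l_1, ..., l_N} is given by its enumeration l; the
   elements of U are distinct when l is injective. *)
Variables (N : nat) (l : 'I_N -> int).

Definition gap (k j : 'I_N) : R := (l k - l j)%:~R * sampling_step.

Definition S11 : 'M[R]_N :=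
  \matrix_(k, j) (Num.sqrt (2 * pi) * phit1 (gap k j)).

Definition S12 : 'M[R]_N :=
  \matrix_(k, j) (- (Num.sqrt (2 * pi) * phit2 (gap k j))).

Definition S21 : 'M[R]_N :=
  \matrix_(k, j) (Num.sqrt (2 * pi) * derive1 phit1 (gap k j)).

Definition S22 : 'M[R]_N :=
  \matrix_(k, j) (- (Num.sqrt (2 * pi) * derive1 phit2 (gap k j))).

End Oversampling.

(* Main.v *)
Require Import Defs.
From HB Require Import structures.
From mathcomp Require Import all_boot all_order all_algebra.
From mathcomp Require Import all_classical all_reals all_analysis.
From mathcomp Require Import ring.
Set Implicit Arguments.
Unset Strict Implicit.
Unset Printing Implicit Defensive.
Import Order.TTheory GRing.Theory Num.Theory.
Import numFieldNormedType.Exports.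
Local Open Scope ring_scope.

(** Write c for (sqrt (2 pi))^-1. Since omega * sampling_step / 2 = r * pi and
    m * r is an integer, every gap x between two points of the index set
    satisfies omega * x / 2 = n * pi with n an integer, so that
    sin (omega * x / 2) = 0. By the duplication formulas sin (omega * x) = 0
    and cos (omega * x) = 1 follow. At a nonzero gap both sinc (omega * x) and
    sinc (omega * x / 2) therefore vanish: phit1 and phit2 are zero there, and
    so is the derivative of phit2, where sinc ^+ 2 has a double zero. In the
    derivative of phit1 only the simple zero of sinc (omega * x) contributes,
    with the value c * 2 r (1 - r) cos (omega * x) / x, that is
    c * 2 r (1 - r) / x. At the zero gap, which by injectivity occurs exactly
    on the diagonal, sinc is 1 with derivative 0.

    The analytic input is the derivative of sinc. Away from 0 it comes from the
    quotient rule; at 0 the bound |sinc y - 1| <= y ^+ 2, obtained from three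
    uses of the mean value theorem, shows that it exists and vanishes. Thanks
    to the convention 0^-1 = 0 both cases are given by the one formula
    (cos y - sinc y) / y of [is_derive_sinc]. *)

(** * The derivative of sinc *)

Section SincDerivative.
Variable R : realType.
Implicit Types (f df : R -> R) (x y : R).

(** Bounding the intermediate point by |y| treats both signs of y at once. *)
Lemma MVT_from0 f df y : (forall x, is_derive x 1 f (df x)) ->
  exists2 c, `|c| <= `|y| & f y - f 0 = df c * y.
Proof.
move=> fdf.
have fcont a b : {within `[a, b], continuous f}%classic.
  apply/continuous_subspaceT => x.
  exact/differentiable_continuous/derivable1_diffP.
have [y0|/ltW y0] := leP 0 y.
  have [c] := MVT_segment y0 (fun x _ => fdf x) (fcont _ _).
  rewrite in_itv/= subr0 => /andP[c0 cy] fE.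
  by exists c => //; rewrite !ger0_norm.
have [c] := MVT_segment y0 (fun x _ => fdf x) (fcont _ _).
rewrite in_itv/= sub0r => /andP[yc c0] fE.
exists c; first by rewrite !ler0_norm// lerN2.
by rewrite -opprB fE mulrN opprK.
Qed.

(** The bounds for sin, cos - 1 and sin - id follow from one another, starting
    with |cos| <= 1: each function has, up to sign, the previous one as
    derivative, and the mean value theorem from 0 gains one power of |y|. The constants are far from optimal, but only the
    exponents matter for the slope of sinc at 0. *)
Lemma norm_sin_le y : `|sin y| <= `|y|.
Proof.
have [c _] := MVT_from0 y (@is_derive_sin R).
rewrite sin0 subr0 => ->; rewrite normrM.
by rewrite ler_piMl// cos_max.
Qed.

Lemma norm_cosB1_le y : `|cos y - 1| <= `|y| ^+ 2.
Proof.
have [c cy] := MVT_from0 y (@is_derive_cos R).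
rewrite cos0 => ->; rewrite normrM normrN expr2.
by rewrite ler_wpM2r// (le_trans (norm_sin_le c)).
Qed.

Lemma norm_sinB_le y : `|sin y - y| <= `|y| ^+ 3.
Proof.
have dE x : is_derive x 1 (fun z : R => sin z - z) (cos x - 1).
  exact: is_deriveB.
have [c cy] := MVT_from0 y dE.
rewrite sin0 !subr0 => ->; rewrite normrM exprSr ler_wpM2r//.
by rewrite (le_trans (norm_cosB1_le c))// lerXn2r// nnegrE.
Qed.

Lemma sinc0 : sinc 0 = 1 :> R.
Proof. by rewrite /sinc eqxx. Qed.

Lemma sincE y : y != 0 -> sinc y = sin y / y.
Proof. by rewrite /sinc => /negPf ->. Qed.

Lemma norm_sincB1_le y : `|sinc y - 1| <= `|y| ^+ 2.
Proof.
have [->|y0] := eqVneq y 0; first by rewrite sinc0 subrr normr0 expr0n.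
have -> : sinc y - 1 = (sin y - y) / y by rewrite sincE// mulrBl divff.
by rewrite normrM normfV ler_pdivrMr ?normr_gt0// -exprSr norm_sinB_le.
Qed.

(** The slope between 0 and z is squeezed between -|z| and |z|. *)
Lemma is_derive0_quadratic f :
  (forall z, `|f z - f 0| <= `|z| ^+ 2) -> is_derive (0 : R) 1 f 0.
Proof.
move=> fle; apply/is_derive1_caratheodory.
exists (fun z => (f z - f 0) / z); split.
- move=> z; rewrite subr0.
  by have [->|z0] := eqVneq z 0; rewrite ?subrr ?mul0r// divfK.
- rewrite /= /prop_for /continuous_at/= subrr mul0r.
  have n0 : (`|z| @[z --> (0 : R)] --> (0 : R))%classic.
    by rewrite -[X in (_ --> X)%classic](@normr0 _ R); exact: norm_continuous.
  have nN0 : (- `|z| @[z --> (0 : R)] --> (0 : R))%classic.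
    by rewrite -[X in (_ --> X)%classic]oppr0; exact: cvgN.
  apply: (squeeze_cvgr _ nN0 n0).
  apply: nearW => z; rewrite -ler_norml.
  have [->|z0] := eqVneq z 0; first by rewrite invr0 mulr0 normr0.
  by rewrite normrM normfV ler_pdivrMr ?normr_gt0// -expr2.
- by rewrite subrr mul0r.
Qed.

(** At y = 0 the stated derivative reads 0 / 0 = 0. *)
Lemma is_derive_sinc y : is_derive y 1 (@sinc R) ((cos y - sinc y) / y).
Proof.
have [->|y0] := eqVneq y 0.
  rewrite cos0 sinc0 subrr mul0r; apply: is_derive0_quadratic => z.
  by rewrite sinc0 norm_sincB1_le.
have near_sinc : (\near y, sin y * y^-1 = sinc y)%classic.
  near=> z; rewrite sincE//.
  by near: z; exact: open_neq.
apply: (near_eq_is_derive near_sinc).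
have dV := @is_deriveV R id y 1 1 y0 (is_derive_id y 1).
apply: is_derive_eq; rewrite sincE// /GRing.scale/=.
by field.
Unshelve. all: by end_near. Qed.

End SincDerivative.

(** * The kernels at zero and nonzero gaps *)

Section Kernels.
Variables (R : realType) (omega r : R).
Local Notation c := (Num.sqrt (2 * pi))^-1.

(** The chain rule factor a cancels: a / (a * x) = 1 / x. For a = 0 or x = 0
    both sides are 0, because cos 0 - sinc 0 = 0. *)
Lemma is_derive_sinc_scale (a x : R) :
  is_derive x 1 (fun z => sinc (a * z)) ((cos (a * x) - sinc (a * x)) / x).
Proof.
have da : is_derive x 1 (fun z : R => a * z) a.
  have := is_deriveZ a (is_derive_id x (1 : R)).
  by move=> H; apply: is_derive_eq; rewrite /GRing.scale/= mulr1.
have dl := @is_derive1_comp R (@sinc R) _ x _ _ (is_derive_sinc (a * x)) da.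
apply: is_derive_eq.
have [->|a0] := eqVneq a 0; first by rewrite !mul0r cos0 sinc0 subrr !mul0r.
have [->|x0] := eqVneq x 0; first by rewrite mulr0 cos0 sinc0 subrr !mul0r.
by field; rewrite x0.
Qed.

Lemma derive1_phit1 x : derive1 (phit1 omega r) x =
  c * (2 * r * (1 - r) * ((cos (omega * x) - sinc (omega * x)) / x) +
       r ^+ 2 * (2 * sinc (omega / 2 * x) *
         ((cos (omega / 2 * x) - sinc (omega / 2 * x)) / x))).
Proof.
have -> : phit1 omega r = c *: (((2 * r * (1 - r)) *: fun z => sinc (omega * z))
    + r ^+ 2 *: (fun z => sinc (omega / 2 * z)) ^+ 2).
  apply/funext => z.
  by rewrite /phit1 (mulrAC omega) /= !fctE.
have d1 := is_derive_sinc_scale omega x.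
have d2 := is_derive_sinc_scale (omega / 2) x.
have d := is_deriveZ c (is_deriveD (is_deriveZ (2 * r * (1 - r)) d1)
  (is_deriveZ (r ^+ 2) (is_deriveX 2 d2))).
by rewrite derive1E (@derive_val _ _ _ _ _ _ _ d) expr1.
Qed.

Lemma derive1_phit2 x : derive1 (phit2 omega r) x =
  - (c * r ^+ 2 * (sinc (omega / 2 * x) ^+ 2 + x * (2 * sinc (omega / 2 * x) *
         ((cos (omega / 2 * x) - sinc (omega / 2 * x)) / x)))).
Proof.
have -> : phit2 omega r =
    - ((c * r ^+ 2) *: (id * (fun z => sinc (omega / 2 * z)) ^+ 2)).
  apply/funext => z.
  by rewrite /phit2 (mulrAC omega) /= !fctE /GRing.scale/= !mulrA.
have d2 := is_derive_sinc_scale (omega / 2) x.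
rewrite derive1E derive_val /= expr1.
rewrite /GRing.scale/= !fctE; ring.
Qed.

Lemma phit1_0 : phit1 omega r 0 = c * (2 * r - r ^+ 2).
Proof. by rewrite /phit1 !(mulr0, mul0r) sinc0; ring. Qed.

Lemma phit2_0 : phit2 omega r 0 = 0.
Proof. by rewrite /phit2 !(mulr0, mul0r) oppr0. Qed.

Lemma derive1_phit1_0 : derive1 (phit1 omega r) 0 = 0.
Proof. by rewrite derive1_phit1 invr0 !mulr0 addr0 mulr0. Qed.

Lemma derive1_phit2_0 : derive1 (phit2 omega r) 0 = - (c * r ^+ 2).
Proof.
by rewrite derive1_phit2 mul0r addr0 mulr0 sinc0 expr1n mulr1.
Qed.

(** Everything is expressed through the half angle omega / 2 * x: once its sine
    vanishes, the duplication formulas settle the full angle omega * x. *)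
Section NonzeroGap.
Variable x : R.
Hypotheses (omega_neq0 : omega != 0) (x_neq0 : x != 0).
Hypothesis sin_half : sin (omega / 2 * x) = 0.

Let sinc_half : sinc (omega / 2 * x) = 0.
Proof. by rewrite sincE ?sin_half ?mul0r// !mulf_neq0// invr_neq0. Qed.

Let omega_double : omega * x = (omega / 2 * x) *+ 2.
Proof. by rewrite mulr2n; field. Qed.

Let cos_omega : cos (omega * x) = 1.
Proof.
rewrite omega_double cos_mulr2n cos2sin2 sin_half expr0n/= subr0.
by rewrite mulr2n addrK.
Qed.

Let sinc_omega : sinc (omega * x) = 0.
Proof.
rewrite sincE ?mulf_neq0// omega_double sin_mulr2n sin_half.
by rewrite mulr0 mul0rn mul0r.
Qed.

Lemma phit1_eq0 : phit1 omega r x = 0.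
Proof.
by rewrite /phit1 (mulrAC omega) sinc_half sinc_omega expr0n/= !mulr0 addr0 mulr0.
Qed.

Lemma phit2_eq0 : phit2 omega r x = 0.
Proof.
by rewrite /phit2 (mulrAC omega) sinc_half expr0n/= !mulr0 oppr0.
Qed.

Lemma derive1_phit1_neq0 :
  derive1 (phit1 omega r) x = c * (2 * r * (1 - r) / x).
Proof.
rewrite derive1_phit1 cos_omega sinc_omega sinc_half.
by rewrite subr0 mulr0 mul0r mulr0 addr0 mul1r.
Qed.

Lemma derive1_phit2_eq0 : derive1 (phit2 omega r) x = 0.
Proof.
by rewrite derive1_phit2 sinc_half mulr0 mul0r mulr0 expr0n/= addr0 mulr0 oppr0.
Qed.

End NonzeroGap.

End Kernels.

(** * The four matrices *)

Lemma sin_int_pi (R : realType) (n : int) : sin (n%:~R * pi) = 0 :> R.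
Proof.
have sin_nat k : sin (k%:R * pi) = 0 :> R.
  elim: k => [|k IH]; first by rewrite mul0r sin0.
  by rewrite mulrSr mulrDl mul1r sinDpi IH oppr0.
by case: n => k; rewrite ?NegzE ?mulrNz ?mulNr ?sinN sin_nat ?oppr0.
Qed.

Theorem proposition4p1 (R : realType) (omega r : R) (N m : nat)
    (i : 'I_N -> int) (l : 'I_N -> int)
    (omega_gt0 : 0 < omega) (r_gt0 : 0 < r) (r_lt1 : r < 1)
    (N_gt0 : (0 < N)%N) (m_gt0 : (0 < m)%N) (i_inj : injective i)
    (l_def : forall k, l k = m%:Z * i k)
    (mr_int : m%:R * r \is a Num.int) :
  [/\ S11 omega r l = (2 * r - r ^+ 2)%:M,
      S22 omega r l = (r ^+ 2)%:M,
      S12 omega r l = 0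
    & forall k j : 'I_N,
        S21 omega r l k j =
          if k == j then 0
          else (1 - r) * (omega / (m%:R * pi * (i k - i j)%:~R))].
Proof.
have omega0 : omega != 0 by rewrite gt_eqF.
have r0 : r != 0 by rewrite gt_eqF.
have m0 : m%:R != 0 :> R by rewrite pnatr_eq0 -lt0n.
have pi0 : pi != 0 :> R by rewrite gt_eqF// pi_gt0.
have s0 : Num.sqrt (2 * pi) != 0 :> R.
  by rewrite sqrtr_eq0 -ltNge mulr_gt0// pi_gt0.
have gapE k j : gap omega r l k j =
    m%:R * (i k - i j)%:~R * (2 * pi * r / omega).
  by rewrite /gap !l_def -mulrBr intrM.
have gap_diag k : gap omega r l k k = 0.
  by rewrite /gap subrr mul0r.
have diff0 k j : k != j -> (i k - i j)%:~R != 0 :> R.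
  by move=> kj; rewrite intr_eq0 subr_eq0 (inj_eq i_inj).
have gap_neq0 k j : k != j -> gap omega r l k j != 0.
  by move=> kj; rewrite gapE !mulf_neq0 ?invr_neq0 ?diff0.
have sin_gap k j : sin (omega / 2 * gap omega r l k j) = 0.
  (* The angle equals m * r * (i k - i j) * pi: the integrality of m * r makes
     it an integer multiple of pi. *)
  have /intrP[n mrE] := mr_int.
  have -> : omega / 2 * gap omega r l k j = (n * (i k - i j))%:~R * pi.
    by rewrite gapE intrM -mrE; field.
  exact: sin_int_pi.
split.
- apply/matrixP => k j; rewrite !mxE; case: eqVneq => [->|kj].
    by rewrite gap_diag phit1_0 mulVKf.
  by rewrite phit1_eq0 ?gap_neq0// mulr0.
- apply/matrixP => k j; rewrite !mxE; case: eqVneq => [->|kj].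
    by rewrite gap_diag derive1_phit2_0 mulrN opprK mulVKf.
  by rewrite derive1_phit2_eq0 ?gap_neq0// mulr0 oppr0.
- apply/matrixP => k j; rewrite !mxE.
  have [->|kj] := eqVneq k j; first by rewrite gap_diag phit2_0 mulr0 oppr0.
  by rewrite phit2_eq0 ?gap_neq0// mulr0 oppr0.
- move=> k j; rewrite mxE.
  have [->|kj] := eqVneq k j; first by rewrite gap_diag derive1_phit1_0 mulr0.
  rewrite derive1_phit1_neq0 ?gap_neq0// mulVKf// gapE.
  have := diff0 _ _ kj; rewrite intrB => ij0.
  (* [field] must see pi as an atom, not as the zero of cos defining it. *)
  move: pi pi0 => p p0.
  by field; rewrite ij0 p0 m0 omega0 r0.
Qed.
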